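(* For every even integer $n\ge 8$ there exists a $3$-connected nonplanar cubic graph $G$ with $n$ vertices and exactly $2$ edge-Kempe equivalence classes of proper $3$-edge colorings, i.e. $K'(G,3)=2$.
   Context: A proper $3$-edge coloring assigns colors from $\{1,2,3\}$ to edges so that adjacent edges receive different colors. For colors $a\neq b$, an edge-Kempe chain is a connected component of the subgraph of edges colored $a$ or $b$; an edge-Kempe switch interchanges $a$ and $b$ on one chain. $K'(G,3)$ is the number of equivalence classes of proper $3$-edge colorings of $G$ under the equivalence relation generated by edge-Kempe switches. *)

(* Defs.v *)
(* Finite simple graphs as symmetric irreflexive relations. *)
From mathcomp Require Import all_boot.
Set Implicit Arguments. Unset Strict Implicit. Unset Printing Implicit Defensive.

Section Graphs.
Variables (V : finType) (e : rel V).

Definition nbhd (u : V) : {set V} := [set v | e u v].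
Definition cubic : Prop := forall u : V, #|nbhd u| = 3.

Definition edges : {set {set V}} := [set [set p.1; p.2] | p in [set p : V * V | e p.1 p.2]].

Definition connected_on (S : {set V}) : Prop :=
  forall u v, u \in S -> v \in S ->
    connect [rel x y | [&& e x y, x \in S & y \in S]] u v.

Definition three_connected : Prop :=
  3 < #|V| /\ forall X : {set V}, #|X| <= 2 -> connected_on (~: X).

(* Combinatorial planarity via rotation systems (combinatorial embeddings):
   rho u is a cyclic ordering of the neighbours of u; faces are the orbits
   of the face-tracing map (u,v) |-> (v, rho v u) on darts.  A connected graph
   is planar iff some rotation system has Euler characteristic 2. *)
Definition rotation_system (rho : V -> V -> V) : Prop :=
  forall u : V,
    [/\ {in nbhd u, forall v, rho u v \in nbhd u},
        {in nbhd u &, injective (rho u)} &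
        {in nbhd u &, forall v w, fconnect (rho u) v w}].

Definition darts : {set V * V} := [set p : V * V | e p.1 p.2].

Definition face_step (rho : V -> V -> V) (p : V * V) : V * V := (p.2, rho p.2 p.1).

Definition faces (rho : V -> V -> V) : {set {set V * V}} :=
  [set [set y in darts | fconnect (face_step rho) x y] | x in darts].

Definition planar : Prop :=
  exists rho : V -> V -> V,
    rotation_system rho /\ #|V| + #|faces rho| = #|edges| + 2.

Definition edge := {x : {set V} | x \in edges}.
Definition coloring := {ffun edge -> 'I_3}.

Definition adj_edges (f g : edge) : bool :=
  (f != g) && (val f :&: val g != set0).

Definition proper (c : coloring) : bool :=
  [forall f, forall g, adj_edges f g ==> (c f != c g)].

Definition ab_col (c : coloring) (a b : 'I_3) (f : edge) : bool :=
  (c f == a) || (c f == b).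

Definition ab_rel (c : coloring) (a b : 'I_3) : rel edge :=
  fun f g => [&& ab_col c a b f, ab_col c a b g & adj_edges f g].

Definition chain (c : coloring) (a b : 'I_3) (f : edge) : {set edge} :=
  [set g | connect (ab_rel c a b) f g].

Definition swap_col (a b x : 'I_3) : 'I_3 :=
  if x == a then b else if x == b then a else x.

Definition kempe_switch (c : coloring) (a b : 'I_3) (f : edge) : coloring :=
  [ffun g => if g \in chain c a b f then swap_col a b (c g) else c g].

Definition kempe_step (c d : coloring) : bool :=
  [&& proper c, proper d &
      [exists a, exists b, exists f,
         [&& a != b, ab_col c a b f & d == kempe_switch c a b f]]].

Definition kempe_equiv : rel coloring :=
  connect [rel c d | kempe_step c d || kempe_step d c].

Definition Kprime3 : nat :=
  #|equivalence_partition kempe_equiv [set c : coloring | proper c]|.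

End Graphs.

(* Main.v *)
Require Import Defs.
From mathcomp Require Import all_boot zify.
Set Implicit Arguments. Unset Strict Implicit. Unset Printing Implicit Defensive.

(* Start from K_{3,3} and repeatedly replace a vertex by a triangle; each
   replacement adds two vertices and keeps the graph cubic and 3-connected.

   Colourings: sending each triangle edge to the outer edge opposite to it is a
   retraction of line graphs, and in a proper 3-colouring these two edges have
   the same colour.  Pulling back along it is therefore a bijection between the
   proper colourings of the two graphs, and it matches Kempe chains with Kempe
   chains.  For K_{3,3} proper colourings are Latin squares of order 3, and the
   two classes are the circulant and the back-circulant squares.

   Planarity: from a rotation system on the expanded graph one obtains one on
   the original graph with at most one face fewer, so that the inequality
   V + F < E + 2 (for all rotation systems) is inherited.  For K_{3,3} it holds
   because every face has at least four of the 18 darts. *)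

Local Notation proper := Defs.proper.

(** * Edge-Kempe classes *)

Lemma connect_homo (T T' : finType) (r : rel T) (r' : rel T') (h : T -> T') :
  (forall x y, r x y -> connect r' (h x) (h y)) ->
  forall x y, connect r x y -> connect r' (h x) (h y).
Proof.
move=> hr x y /connectP[p]; elim: p x => [|z p IH] x /=; first by move=> _ ->.
by case/andP=> xz zp yl; apply: connect_trans (hr _ _ xz) (IH _ zp yl).
Qed.

Section Kempe.
Variables (V : finType) (e : rel V).
Implicit Types (c d : coloring e) (f g : edge e) (a b : 'I_3).

Lemma adj_edges_sym : symmetric (@adj_edges V e).
Proof. by move=> f g; rewrite /adj_edges eq_sym setIC. Qed.

Lemma proper_coloringP c :
  reflect (forall f g, adj_edges f g -> c f != c g) (proper c).
Proof.
apply: (iffP forallP) => [H f g fg|H f].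
  by have /forallP/(_ g)/implyP/(_ fg) := H f.
by apply/forallP => g; apply/implyP => /H.
Qed.

Lemma ab_rel_sym c a b : symmetric (ab_rel c a b).
Proof. by move=> f g; rewrite /ab_rel adj_edges_sym; case: ab_col => //=; rewrite andbC. Qed.

Lemma chain_step c a b f g h :
  ab_rel c a b g h -> (g \in chain c a b f) = (h \in chain c a b f).
Proof.
move=> gh; rewrite !inE; have ss := sym_connect_sym (ab_rel_sym c a b).
by rewrite ![connect _ f _]ss (same_connect ss (connect1 gh)).
Qed.

Lemma ab_col_chain c a b f g :
  ab_col c a b f -> g \in chain c a b f -> ab_col c a b g.
Proof.
move=> fab; rewrite inE => /connectP[p]; elim: p f fab => [|h p IH] f fab /=.
  by move=> _ ->.
by case/andP=> /and3P[_ hab _]; apply: IH.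
Qed.

Lemma swap_col_inj a b : injective (swap_col a b).
Proof.
move=> x y; rewrite /swap_col.
case: (x =P a) => [->|xa]; case: (y =P a) => [->|ya] //.
- by case: (y =P b) => [->|yb] // by_; case: yb.
- by case: (x =P b) => [->|xb] // xb'; case: xb.
- by case: (x =P b) => [->|xb]; case: (y =P b) => [->|yb] // H; case: ya.
Qed.

Lemma swap_col_ab c a b f : ab_col c a b f ->
  (swap_col a b (c f) == a) || (swap_col a b (c f) == b).
Proof.
rewrite /ab_col /swap_col; case: (c f =P a) => [_ _|_ /= ->]; first by rewrite eqxx orbT.
by rewrite eqxx.
Qed.

(** Only an edge of the chain and an adjacent edge outside it can conflict. The outer one has
    neither colour [a] nor [b], else it would belong to the chain, while the switched one still has
    one of these two colours. *)
Lemma kempe_switch_proper c a b f :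
  proper c -> ab_col c a b f -> proper (kempe_switch c a b f).
Proof.
move=> /proper_coloringP pc fab; apply/proper_coloringP => g h gh; rewrite !ffunE.
have [gC|gC] := boolP (g \in _); have [hC|hC] := boolP (h \in _).
- by rewrite (inj_eq (@swap_col_inj a b)) pc.
- have gab := ab_col_chain fab gC.
  have: ~~ ab_col c a b h.
    apply: contraNN hC => hab; rewrite -(@chain_step c a b f g h) //.
    by rewrite /ab_rel gab hab.
  have := swap_col_ab gab; rewrite /ab_col.
  by case/orP=> /eqP ->; rewrite negb_or ![c h == _]eq_sym => /andP[].
- have hab := ab_col_chain fab hC.
  have: ~~ ab_col c a b g.
    apply: contraNN gC => gab; rewrite (@chain_step c a b f g h) //.
    by rewrite /ab_rel gab hab.
  have := swap_col_ab hab; rewrite /ab_col.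
  by case/orP=> /eqP ->; rewrite negb_or => /andP[].
- exact: pc.
Qed.

Lemma kempe_equiv_step c a b f :
  proper c -> a != b -> ab_col c a b f -> kempe_equiv c (kempe_switch c a b f).
Proof.
move=> pc ab fab; apply: connect1; rewrite /= /kempe_step pc kempe_switch_proper //=.
by apply/orP; left; apply/existsP; exists a; apply/existsP; exists b;
   apply/existsP; exists f; rewrite ab fab eqxx.
Qed.

Lemma kempe_stepP c d :
  reflect [/\ proper c, proper d & exists a b f,
             [/\ a != b, ab_col c a b f & d = kempe_switch c a b f]]
          (kempe_step c d).
Proof.
apply: (iffP and3P) => -[pc pd H]; split => //.
  by have /existsP[a /existsP[b /existsP[f /and3P[? ? /eqP]]]] := H; exists a, b, f.
have [a [b [f [ab fab ->]]]] := H; apply/existsP; exists a; apply/existsP; exists b.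
by apply/existsP; exists f; rewrite ab fab eqxx.
Qed.

(** A complete Boolean invariant with both values attained encodes having exactly two classes, in a
    form that transports along triangle replacement. *)
Definition separates_classes (phi : coloring e -> bool) : Prop :=
  {in @proper V e &, forall c d, kempe_equiv c d = (phi c == phi d)} /\
  forall t, exists2 c, proper c & phi c = t.

Lemma Kprime3_eq2 phi : separates_classes phi -> Kprime3 e = 2.
Proof.
case=> phiE phi_onto.
pose P t := [set c : coloring e | proper c & phi c == t].
suff ->: Kprime3 e = #|[set P true; P false]|.
  rewrite cards2; case: eqP => // /setP E.
  by have [c pc ct] := phi_onto true; have := E c; rewrite !inE pc ct.
congr #|pred_of_set _|; apply/setP => X; rewrite !inE.
have cls c : proper c -> [set d in [set d | proper d] | kempe_equiv c d] = P (phi c).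
  move=> pc; apply/setP => d; rewrite !inE; case pd: (proper d) => //=.
  by rewrite phiE // eq_sym.
apply/imsetP/idP => [[c]|].
  rewrite inE => pc ->; rewrite cls //; case: (phi c); by rewrite eqxx ?orbT.
by case/orP=> /eqP ->; [have [c pc <-] := phi_onto true|have [c pc <-] := phi_onto false];
  exists c; rewrite ?inE ?cls.
Qed.

End Kempe.

(** * Colourings and triangle replacement *)

Section TriangleColorings.
Variables (V V' : finType) (e : rel V) (e' : rel V').
(* The triangle edge [t k] is opposite to the outer edge [j (s k)]. *)
Variables (j : edge e -> edge e') (r : edge e' -> edge e).
Variables (s : 'I_3 -> edge e) (t : 'I_3 -> edge e').
Hypothesis jK : cancel j r.
Hypothesis rt : forall k, r (t k) = s k.
Hypothesis edge'P : forall u, u = j (r u) \/ exists k, u = t k.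
Hypothesis r_adj : forall u w, adj_edges u w -> adj_edges (r u) (r w).
Hypothesis j_adj : forall f g, adj_edges f g ->
  adj_edges (j f) (j g) \/ exists k l, f = s k /\ g = s l.
Hypothesis t_adj : forall k l, k != l -> adj_edges (t k) (t l).
Hypothesis st_adj : forall k l, k != l -> adj_edges (j (s k)) (t l).

Let up (c : coloring e) : coloring e' := [ffun u => c (r u)].
Let down (c : coloring e') : coloring e := [ffun f => c (j f)].

Let upK : cancel up down.
Proof. by move=> c; apply/ffunP => f; rewrite !ffunE jK. Qed.

Let up_proper c : proper c -> proper (up c).
Proof. by move/proper_coloringP=> pc; apply/proper_coloringP => u w /r_adj/pc; rewrite !ffunE. Qed.

(* The three triangle edges have distinct colours, so each has the colour of
   the outer edge it does not touch. *)
Let color_t c k : proper c -> c (j (s k)) = c (t k).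
Proof.
move/proper_coloringP=> pc.
have ct_inj : injective (c \o t).
  by move=> x y /= E; apply/eqP/contraT => /t_adj/pc; rewrite E eqxx.
have /codomP[l El] := injF_onto ct_inj (c (j (s k))).
by have [kl|/st_adj/pc] := eqVneq k l; rewrite El ?eqxx //= -kl.
Qed.

Let downK c : proper c -> up (down c) = c.
Proof.
move=> pc; apply/ffunP => u; rewrite !ffunE.
by case: (edge'P u) => [<- //|[k ->]]; rewrite rt color_t.
Qed.

Let s_neq k l c : proper c -> c (j (s k)) = c (j (s l)) -> k = l.
Proof.
move=> pc; rewrite !color_t // => E; apply/eqP/contraT => /t_adj.
by move/proper_coloringP: pc => pc /pc; rewrite E eqxx.
Qed.

Let down_proper c : proper c -> proper (down c).
Proof.
move=> pc; apply/proper_coloringP => f g fg; rewrite !ffunE.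
case: (j_adj fg) => [|[k [l [fE gE]]]]; first by move/proper_coloringP: pc => pc /pc.
rewrite fE gE; apply/eqP => /(s_neq pc) E.
by move: fg; rewrite fE gE E /adj_edges eqxx.
Qed.

Let ab_col_up c a b u : ab_col (up c) a b u = ab_col c a b (r u).
Proof. by rewrite /ab_col ffunE. Qed.

(** Paths upstairs project along [r]. Conversely [j] lifts adjacency except between two outer edges
    at the replaced vertex, and there a detour through the triangle edges of the same two colours
    restores the connection. *)
Let chain_up c a b u w : proper c -> a != b -> ab_col c a b (r u) ->
  (w \in chain (up c) a b u) = (r w \in chain c a b (r u)).
Proof.
move=> pc nab uab; pose E := ab_rel (up c) a b.
have Esym := sym_connect_sym (ab_rel_sym (up c) a b).
have cs k : c (s k) = up c (j (s k)) by rewrite ffunE jK.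
(* These two edges are disjoint. Let [s l] be the edge at the vertex carrying the other of the
   colours [a], [b]; then [t l] has that colour and touches both. *)
have sj k : ab_col c a b (s k) -> connect E (j (s k)) (t k).
  move=> kab; have [l kl lab] : exists2 l, k != l & ab_col c a b (s l).
    pose y := if c (s k) == a then b else a.
    have sinj : injective (c \o s).
      by move=> x z /=; rewrite !cs; apply: s_neq; apply: up_proper.
    have /codomP[l /= yl] := injF_onto sinj y; exists l; last first.
      by rewrite /ab_col -yl /y; case: ifP => _; rewrite eqxx ?orbT.
    apply/eqP => kl; move: yl; rewrite -kl /y.
    case: eqP => [-> ba|ne ka]; last by case: ne.
    by rewrite ba eqxx in nab.
  apply: (@connect_trans _ _ (t l)); apply: connect1;
    rewrite /E /ab_rel !ab_col_up ?jK !rt kab lab /=.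
    exact: st_adj.
  by rewrite t_adj // eq_sym.
have ju x : ab_col c a b (r x) -> connect E x (j (r x)).
  by case: (edge'P x) => [<- //|[k ->]]; rewrite rt => /sj; rewrite /E Esym.
rewrite !inE; apply/idP/idP.
  apply: connect_homo => x y /and3P[]; rewrite !ab_col_up => xab yab /r_adj xy.
  by apply: connect1; rewrite /ab_rel xab yab.
move=> uw; have wab : ab_col c a b (r w) by apply: (ab_col_chain uab); rewrite inE.
rewrite -/E; apply: connect_trans (ju _ uab) _; rewrite /E Esym.
apply: connect_trans (ju _ wab) _; rewrite /E Esym.
apply: (connect_homo _ uw) => f g /and3P[fab gab fg].
case: (j_adj fg) => [jfg|[k [l [fE gE]]]].
  by apply: connect1; rewrite /E /ab_rel !ab_col_up !jK fab gab.
have kl : k != l by apply: contraTneq fg => kl; rewrite fE gE kl /adj_edges eqxx.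
rewrite fE gE; rewrite fE in fab; rewrite gE in gab.
apply: connect_trans (sj _ fab) _; rewrite Esym; apply: connect_trans (sj _ gab) _.
by apply: connect1; rewrite /E /ab_rel !ab_col_up !rt fab gab t_adj // eq_sym.
Qed.

Let switch_up c a b u : proper c -> a != b -> ab_col c a b (r u) ->
  kempe_switch (up c) a b u = up (kempe_switch c a b (r u)).
Proof.
by move=> pc ab uab; apply/ffunP => w; rewrite !ffunE chain_up.
Qed.

Let step_up c d : kempe_step c d -> kempe_step (up c) (up d).
Proof.
case/kempe_stepP=> pc pd [a [b [f [ab fab ->]]]]; apply/kempe_stepP; split.
- exact: up_proper.
- by apply: up_proper; apply: kempe_switch_proper.
by exists a, b, (j f); rewrite ab_col_up jK switch_up ?jK.
Qed.

Let step_down c d : kempe_step c d -> kempe_step (down c) (down d).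
Proof.
case/kempe_stepP=> pc pd [a [b [u [ab uab dE]]]]; apply/kempe_stepP.
split; [exact: down_proper|exact: down_proper|exists a, b, (r u)].
rewrite -(downK pc) ab_col_up in uab.
by split=> //; rewrite dE -[c in LHS]downK // switch_up ?upK //; apply: down_proper.
Qed.

Lemma separates_classes_triangle (phi : coloring e -> bool) :
  separates_classes phi -> exists phi' : coloring e' -> bool, separates_classes phi'.
Proof.
case=> phiE phi_onto; exists (fun c => phi (down c)); split=> [c d pc pd|x].
  rewrite -phiE; try exact: down_proper.
  apply/idP/idP; last rewrite -{2}(downK pc) -{2}(downK pd).
    apply: connect_homo => {pc pd c d}c d /orP[] /step_down H;
      by apply: connect1; rewrite /= H ?orbT.
  apply: connect_homo => {pc pd}c' d' /orP[] /step_up H;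
    by apply: connect1; rewrite /= H ?orbT.
by have [c pc <-] := phi_onto x; exists (up c); rewrite ?upK ?up_proper.
Qed.

End TriangleColorings.

Lemma edgesP (V : finType) (e : rel V) (f : {set V}) :
  reflect (exists p q, e p q /\ f = [set p; q]) (f \in edges e).
Proof.
apply: (iffP imsetP) => [[[p q]]|[p [q [epq ->]]]].
  by rewrite inE /= => epq ->; exists p, q.
by exists (p, q); rewrite ?inE.
Qed.

Lemma card_edge (V : finType) (e : rel V) : #|{: edge e}| = #|edges e|.
Proof. exact: card_sig. Qed.

Lemma third_index (k l : 'I_3) : exists2 m, m != k & m != l.
Proof.
have: 0 < #|~: [set k; l]|.
  by rewrite cardsCs setCK card_ord cards2; case: (k != l).
by case/card_gt0P=> m; rewrite !inE negb_or => /andP[]; exists m.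
Qed.

(** * Faces of a rotation system *)

Section Faces.
Variables (V : finType) (e : rel V) (rho : V -> V -> V).

Definition face_of (d : V * V) : {set V * V} :=
  [set y in darts e | fconnect (face_step rho) d y].

Lemma facesE : faces e rho = face_of @: darts e.
Proof. by []. Qed.

Hypothesis rhoP : rotation_system e rho.

(** A fixed neighbour would be an orbit by itself, whereas all neighbours form a single orbit. *)
Lemma rotation_fixfree u p q : e u p -> e u q -> p != q -> rho u p != p.
Proof.
move=> up uq pq; apply: contraNneq pq => pp; have [_ _ /(_ p q)] := rhoP u.
rewrite !inE => /(_ up uq) /iter_findex <-.
by elim: (findex _ _ _) => //= k /eqP <-; rewrite pp.
Qed.

Lemma rotation_three u p q r : nbhd e u = [set p; q; r] -> uniq [:: p; q; r] ->
  [/\ rho u p = q, rho u q = r & rho u r = p] \/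
  [/\ rho u p = r, rho u r = q & rho u q = p].
Proof.
move=> N /=; rewrite !inE andbT negb_or => /andP[/andP[pq pr] qr].
have [cl inj _] := rhoP u.
have [Np Nq Nr] : [/\ p \in nbhd e u, q \in nbhd e u & r \in nbhd e u].
  by rewrite N !inE !eqxx ?orbT.
have fixf y z : y \in nbhd e u -> z \in nbhd e u -> y != z -> rho u y <> y.
  by rewrite !inE => uy uz yz; apply/eqP; apply: rotation_fixfree yz.
have fp := fixf _ _ Np Nq pq; have fq := fixf _ _ Nq Nr qr.
have fr : rho u r <> r by apply: (fixf _ _ Nr Np); rewrite eq_sym.
have ne y z : y \in nbhd e u -> z \in nbhd e u -> y != z -> rho u y <> rho u z.
  by move=> Ny Nz yz /inj E; move: yz; rewrite E ?eqxx.
have npq := ne _ _ Np Nq pq; have npr := ne _ _ Np Nr pr; have nqr := ne _ _ Nq Nr qr.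
have := cl p Np; have := cl q Nq; have := cl r Nr; rewrite N !inE -!orbA.
by case/or3P=> /eqP Er; case/or3P=> /eqP Eq; case/or3P=> /eqP Ep;
  first [left; split; congruence|right; split; congruence|exfalso; congruence].
Qed.

Hypothesis e_sym : symmetric e.

Lemma face_step_dart : {homo face_step rho : d / d \in darts e}.
Proof.
case=> p q; rewrite !inE /= => pq; have [cl _ _] := rhoP q.
by have := cl p; rewrite !inE e_sym => /(_ pq).
Qed.

Lemma face_step_inj : {in darts e &, injective (face_step rho)}.
Proof.
case=> p q [p1 q1]; rewrite !inE /= => pq pq1 [qE]; rewrite -qE in pq1 *.
by have [_ inj _] := rhoP q; move=> /inj ->; rewrite ?inE // e_sym.
Qed.

Lemma face_of_step d : d \in darts e -> face_of (face_step rho d) = face_of d.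
Proof.
move=> dD; have dD1 := face_step_dart dD; apply/setP => y; rewrite !inE.
congr (_ && _); apply/idP/idP; first exact: connect_trans (fconnect1 _ _).
apply: connect_trans.
by rewrite (fconnect_sym_in face_step_dart face_step_inj) // fconnect1.
Qed.

(** A dart labelling that is constant along faces factors through the set of faces, so its number of
    values bounds the number of faces from below. *)
Lemma card_faces_ge (T : finType) (g : V * V -> T) :
  {in darts e, forall d, g (face_step rho d) = g d} ->
  #|g @: darts e| <= #|faces e rho|.
Proof.
move=> gstep; have gconn d y : d \in darts e -> fconnect (face_step rho) d y -> g y = g d.
  move=> dD /iter_findex <-.
  have: iter (findex (face_step rho) d y) (face_step rho) d \in darts e
        /\ g (iter (findex (face_step rho) d y) (face_step rho) d) = g d; last by case.
  elim: (findex _ _ _) => //= k [kD kg].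
  by rewrite face_step_dart ?gstep.
(* [G] reads the label at an arbitrary dart of a face; the option type covers the empty set. *)
pose G (X : {set V * V}) := omap g [pick y in X].
rewrite -(card_imset (mem (g @: darts e)) Some_inj); apply: leq_trans (leq_imset_card G _).
apply/subset_leq_card/subsetP => _ /imsetP[_ /imsetP[d dD ->] ->].
apply/imsetP; exists (face_of d); first by rewrite facesE imset_f.
rewrite /G; case: pickP => [y|/(_ d)]; last by rewrite in_set connect0 dD.
by rewrite in_set => /andP[_ yd] /=; rewrite (gconn _ _ dD yd).
Qed.

End Faces.

Definition i0 : 'I_3 := @Ordinal 3 0 isT.
Definition i1 : 'I_3 := @Ordinal 3 1 isT.
Definition i2 : 'I_3 := @Ordinal 3 2 isT.

Lemma I3P (k : 'I_3) : [\/ k = i0, k = i1 | k = i2].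
Proof.
by case: k => [[|[|[|//]]] ?]; [constructor 1|constructor 2|constructor 3]; apply: val_inj.
Qed.

(** The two cyclic orders on three indices, successor and predecessor modulo 3; negating [o] gives
    the inverse. *)
Definition rot3 (o : bool) (k : 'I_3) : 'I_3 :=
  match val k with
  | 0 => if o then i1 else i2
  | 1 => if o then i2 else i0
  | _ => if o then i0 else i1
  end.

Lemma rot3_inj o : injective (rot3 o).
Proof.
by move=> k l; case: (I3P k) => ->; case: (I3P l) => ->; case: o => /(congr1 val).
Qed.

Lemma rot3_orbit o k l : [\/ l = k, l = rot3 o k | l = rot3 o (rot3 o k)].
Proof.
by case: (I3P k) => ->; case: (I3P l) => ->; case: o;
  first [by constructor 1|by constructor 2|by constructor 3].
Qed.

(* The faces passing through a triangle: [a k] and [a' k] are the faces of the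
   darts entering and leaving the triangle at corner [k], and [b k l] that of
   the dart from corner [k] to corner [l].  Each corner has one of two
   orientations.  If all three agree, the darts of the triangle on one side form
   a face of their own, to be identified with any other one; otherwise exactly
   one corner is turned back on itself, and identifying the exits at two
   suitable corners restores the faces around a single vertex. *)
Lemma triangle_link (T : Type) (a a' : 'I_3 -> T) (b : 'I_3 -> 'I_3 -> T) :
  (forall k, exists o, [/\ a k = b k (rot3 o k),
     b (rot3 o k) k = b k (rot3 (~~ o) k) & b (rot3 (~~ o) k) k = a' k]) ->
  exists (o : bool) (P Q : T), forall (U : Type) (m : T -> U), m P = m Q ->
    (forall k, m (a k) = m (a' (rot3 o k))) /\
    (forall k l, k != l -> exists h, m (b k l) = m (a h)).
Proof.
move=> H.
pose good o P Q := forall (U : Type) (m : T -> U), m P = m Q ->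
    (forall k, m (a k) = m (a' (rot3 o k))) /\
    (forall k l, k != l -> exists h, m (b k l) = m (a h)).
have [o0 H0] := H i0; have [o1 H1] := H i1; have [o2 H2] := H i2.
suff: (good true (a i0) (b i1 i0) \/ good false (a i0) (b i0 i1)) \/
      (good true (a' i0) (a' i1) \/ good true (a' i1) (a' i2) \/ good true (a' i0) (a' i2)).
  case=> [[G|G]|[G|[G|G]]]; [exists true|exists false|exists true|exists true|exists true];
  by eexists; eexists; exact: G.
move: H2 H1 H0; case: o0; case: o1; case: o2; rewrite /rot3 /= => -[? ? ?] [? ? ?] [? ? ?];
[left; left|right; right; right|right; right; left|right; left
|right; left|right; right; left|right; right; right|left; right];
move=> U m E; split=> [k|k l];
try (by case: (I3P k) => ->; rewrite /rot3 /=; congruence);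
case: (I3P k) => ->; case: (I3P l) => -> //= _;
first [exists i0; congruence|exists i1; congruence|exists i2; congruence].
Qed.

(** * Replacing a vertex by a triangle *)

Section Triangle.
Variables (V V' : finType) (e : rel V) (e' : rel V').
(* [e'] is [e] with the vertex [v], whose neighbours are [w k], replaced by the
   triangle of the [x k]; [proj] contracts the triangle.  The value of [inj]
   at [v] is irrelevant as long as [proj (inj v) = v]. *)
Variables (v : V) (w : 'I_3 -> V) (x : 'I_3 -> V').
Variables (inj : V -> V') (proj : V' -> V).
Hypothesis e_sym : symmetric e.
Hypothesis e_irr : irreflexive e.
Hypothesis w_inj : injective w.
Hypothesis x_inj : injective x.
Hypothesis injK : cancel inj proj.
Hypothesis proj_x : forall k, proj (x k) = v.
Hypothesis V'P : forall p, (proj p != v /\ p = inj (proj p)) \/ exists k, p = x k.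
Hypothesis ev : forall y, e v y = (y \in codom w).
Hypothesis e'_ii : forall y z, y != v -> z != v -> e' (inj y) (inj z) = e y z.
Hypothesis e'_ix : forall y k, y != v -> e' (inj y) (x k) = (y == w k).
Hypothesis e'_xx : forall k l, e' (x k) (x l) = (k != l).
Hypothesis e'_sym : symmetric e'.

Let w_neq k : w k != v.
Proof. by apply/eqP => E; have := ev (w k); rewrite codom_f E e_irr. Qed.

Let x_proj p : proj p = v -> exists k, p = x k.
Proof. by case: (V'P p) => [[/eqP]|]. Qed.

Let inj_proj p : proj p != v -> p = inj (proj p).
Proof. by case: (V'P p) => [[]|[k ->]] //; rewrite proj_x eqxx. Qed.

Let x_neq_inj y k : y != v -> (x k == inj y) = false.
Proof. by move=> yv; apply/eqP => E; move: yv; rewrite -(injK y) -E proj_x eqxx. Qed.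

Let e'_irr : irreflexive e'.
Proof.
move=> p; case: (V'P p) => [[pv ->]|[k ->]]; last by rewrite e'_xx eqxx.
by rewrite e'_ii.
Qed.

Let e'_xi y k : y != v -> e' (x k) (inj y) = (y == w k).
Proof. by move=> yv; rewrite e'_sym e'_ix. Qed.

Let e'_proj p q : e' p q -> proj p != proj q -> e (proj p) (proj q).
Proof.
case: (V'P p) => [[pv pE]|[k ->]]; case: (V'P q) => [[qv qE]|[l ->]].
- by rewrite {1}pE {1}qE e'_ii.
- by rewrite {1}pE e'_ix // proj_x => /eqP ->; rewrite e_sym ev codom_f.
- by rewrite {1}qE e'_xi // proj_x => /eqP ->; rewrite ev codom_f.
- by rewrite !proj_x eqxx.
Qed.

Let lift_adj y z : e y z -> exists p q, [/\ e' p q, proj p = y & proj q = z].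
Proof.
move=> yz; have [yv|yv] := eqVneq y v.
  move: yz; rewrite yv ev => /codomP[k ->]; exists (x k), (inj (w k)).
  by rewrite e'_xi // proj_x injK.
have [zv|zv] := eqVneq z v.
  move: yz; rewrite zv e_sym ev => /codomP[k ->]; exists (inj (w k)), (x k).
  by rewrite e'_ix // proj_x injK.
by exists (inj y), (inj z); rewrite e'_ii // !injK.
Qed.

(** A dart outside the triangle is determined by its contraction: fibres away from [v] are single
    points, and a corner is recognised by its outer neighbour because [w] is injective. *)
Let lift_inj1 p q p1 q1 : e' p q -> e' p1 q1 -> proj p = proj p1 ->
  proj q = proj q1 -> proj p != proj q -> p = p1.
Proof.
move=> pq pq1 pE qE npq; have [pv|pv] := eqVneq (proj p) v; last first.
  by rewrite (inj_proj pv) pE -inj_proj // -pE.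
have [k pk] := x_proj pv; have [k1 pk1] := x_proj (etrans (esym pE) pv).
move: npq pq pq1; rewrite pv eq_sym => qv; rewrite (inj_proj qv) pk pk1 e'_xi //.
by rewrite [q1]inj_proj -?qE // e'_xi // => /eqP -> /eqP/w_inj ->.
Qed.

Let lift_inj p q p1 q1 : e' p q -> e' p1 q1 -> proj p = proj p1 ->
  proj q = proj q1 -> proj p != proj q -> p = p1 /\ q = q1.
Proof.
move=> pq pq1 pE qE npq; split; first exact: (lift_inj1 pq pq1).
by apply: (@lift_inj1 q p q1 p1); rewrite // 1?e'_sym // eq_sym.
Qed.

(** * Degrees and connectivity after the replacement *)

Lemma cubic_triangle : cubic e -> cubic e'.
Proof.
move=> e3 p; case: (V'P p) => [[pv pE]|[k ->]].
  rewrite -(e3 (proj p)); have Hne q : e' p q -> proj p != proj q.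
    move=> pq; case: (V'P q) => [[qv qE]|[k ->]]; last by rewrite proj_x.
    by apply: contraTneq pq => E; rewrite pE qE E e'_irr.
  have <- : proj @: nbhd e' p = nbhd e (proj p).
    apply/setP => z; rewrite inE; apply/imsetP/idP => [[q]|].
      by rewrite inE => pq ->; apply: e'_proj (Hne _ pq).
    move=> /lift_adj[p1 [q [pq p1E <-]]]; exists q => //; rewrite inE.
    by rewrite pE -p1E -inj_proj // p1E.
  rewrite card_in_imset // => q q1; rewrite !inE => pq pq1 qE.
  by have [] := lift_inj pq pq1 erefl qE (Hne _ pq).
have -> : nbhd e' (x k) = inj (w k) |: x @: [set~ k].
  apply/setP => q; rewrite !inE; case: (V'P q) => [[qv qE]|[l ->]].
    rewrite qE e'_xi // (inj_eq (can_inj injK)).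
    rewrite [_ \in _](_ : _ = false) ?orbF //.
    by apply/imsetP => -[l _ /eqP]; rewrite eq_sym x_neq_inj.
  by rewrite e'_xx x_neq_inj //= mem_imset // !inE eq_sym.
rewrite cardsU1 (card_imset _ x_inj) cardsC1 card_ord.
rewrite [_ \in _](_ : _ = false) //.
by apply/imsetP => -[l _ /eqP]; rewrite eq_sym x_neq_inj.
Qed.

(** Contract the removed set to [X]. Paths avoiding [X] lift because the fibre of [v] is a clique;
    it remains to lead each surviving vertex that projects into [X] to one that does not. *)
Lemma three_connected_triangle : three_connected e -> three_connected e'.
Proof.
case=> V3 conn; split; first exact: leq_trans V3 (leq_card _ (can_inj injK)).
move=> X' X'2; pose X := proj @: X'.
have X2 : #|X| <= 2 := leq_trans (leq_imset_card _ _) X'2.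
pose E := [rel p q | [&& e' p q, p \in ~: X' & q \in ~: X']]; have Esym : connect_sym E.
  apply: sym_connect_sym => p q; rewrite /E /= e'_sym.
  by congr (_ && _); apply: andbC.
have notX p : proj p \notin X -> p \notin X'.
  by apply: contraNN => pX; apply: imset_f.
have fiber p q : proj p = proj q -> proj p \notin X -> connect E p q.
  move=> pq pX; have qX : proj q \notin X by rewrite -pq.
  have [pv|pv] := eqVneq (proj p) v; last first.
    by rewrite (inj_proj pv) pq -inj_proj // -pq.
  have [k pk] := x_proj pv; have [l ql] := x_proj (etrans (esym pq) pv).
  have [kl|kl] := eqVneq k l; first by rewrite pk ql kl.
  by apply: connect1; rewrite /= !inE !notX // pk ql e'_xx kl.
have main p q : proj p \notin X -> proj q \notin X -> connect E p q.
  move=> pX qX; have := conn X X2 (proj p) (proj q); rewrite !inE => /(_ pX qX).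
  move=> H.
  have ip : connect E p (inj (proj p)) by apply: fiber; rewrite ?injK.
  have iq : connect E (inj (proj q)) q by apply: fiber; rewrite ?injK.
  apply: connect_trans ip (connect_trans _ iq); apply: connect_homo H.
  move=> y z /= /and3P[/lift_adj[p1 [q1 [pq1 <- <-]]]]; rewrite !inE => yX zX.
  apply: (@connect_trans _ _ p1); first by rewrite Esym; apply: fiber; rewrite ?injK.
  apply: (@connect_trans _ _ q1); last by apply: fiber; rewrite ?injK.
  by apply: connect1; rewrite /= !inE pq1 !notX.
have wX k : inj (w k) \notin X' -> w k \notin X.
  apply: contraNN => /imsetP[p pX' pE]; rewrite pE -inj_proj //.
  by rewrite -pE w_neq.
(* A surviving vertex over [X] must be a corner [x k], another corner [x l] having been removed. It
   leaves through its own outer neighbour if that survives. *)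
have out p : p \notin X' -> exists2 q, proj q \notin X & connect E p q.
  move=> pX'; have [pX|] := boolP (proj p \in X); last by exists p.
  have [p1 p1X' p1E] := imsetP pX; have pp1 : p != p1.
    by apply: contraNneq pX' => ->.
  have pv : proj p = v.
    apply/eqP; apply: contraNT pp1 => pv; apply/eqP.
    by rewrite (inj_proj pv) p1E -inj_proj // -p1E.
  have [k pk] := x_proj pv; have [l p1l] := x_proj (etrans (esym p1E) pv).
  have [wkX|/negPn wkX] := boolP (inj (w k) \notin X').
    exists (inj (w k)); rewrite ?injK ?wX //; apply: connect1.
    by rewrite /= !inE pX' wkX pk e'_xi // eqxx.
  (* Both removals are now used up, so the third corner [x m] and its outer neighbour survive and
     give a way out. *)
  have X'E : X' = [set x l; inj (w k)].
    apply/eqP; rewrite eq_sym eqEcard subUset !sub1set -p1l p1X' wkX.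
    by rewrite cards2 p1l x_neq_inj.
  have [m mk ml] := third_index k l.
  have xmX : x m \notin X' by rewrite X'E !inE (inj_eq x_inj) (negPf ml) x_neq_inj.
  have wmX : inj (w m) \notin X'.
    rewrite X'E !inE eq_sym x_neq_inj //= (inj_eq (can_inj injK)).
    by rewrite (inj_eq w_inj).
  exists (inj (w m)); first by rewrite injK wX.
  apply: (@connect_trans _ _ (x m)); apply: connect1; rewrite /= !inE.
    by rewrite pX' xmX pk e'_xx eq_sym mk.
  by rewrite wmX xmX e'_xi // eqxx.
move=> p q; rewrite !inE => /out[p1 p1X pp1] /out[q1 q1X]; rewrite Esym => qq1.
exact: connect_trans pp1 (connect_trans (main _ _ p1X q1X) qq1).
Qed.

(** * The retraction of line graphs *)

Let s_edge k : [set v; w k] \in edges e.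
Proof. by apply/edgesP; exists v, (w k); rewrite ev codom_f. Qed.

Let t_edge k : x @: [set~ k] \in edges e'.
Proof.
have [l lk _] := third_index k k; have [m mk ml] := third_index k l.
apply/edgesP; exists (x l), (x m); rewrite e'_xx eq_sym ml; split=> //.
have -> : [set~ k] = [set l; m].
  apply/eqP; rewrite eq_sym eqEcard cardsC1 card_ord cards2 eq_sym ml andbT.
  by rewrite subUset !sub1set !inE lk mk.
by rewrite imsetU1 imset_set1.
Qed.

Let s k : edge e := exist (fun X => X \in edges e) _ (s_edge k).
Let t k : edge e' := exist (fun X => X \in edges e') _ (t_edge k).

Let lift_edge (f : edge e) : exists u : edge e', proj @: val u == val f.
Proof.
have /edgesP[y [z [/lift_adj[p [q [pq <- <-]]] fE]]] := valP f.
have uP : [set p; q] \in edges e' by apply/edgesP; exists p, q.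
by exists (exist (fun X => X \in edges e') _ uP); rewrite fE /= imsetU1 imset_set1.
Qed.

Let j f := xchoose (lift_edge f).
Let jE f : proj @: val (j f) = val f.
Proof. by apply/eqP; apply: (xchooseP (lift_edge f)). Qed.

(** A triangle edge contracts to the singleton of [v], which is not an edge, so [insub] fails
    exactly on triangle edges. These go to the opposite outer edge, and the default [ord0] is never
    reached. *)
Let r (u : edge e') : edge e :=
  if insub (proj @: val u) is Some f then f
  else s (odflt ord0 [pick k | u == t k]).

Let jK : cancel j r.
Proof. by move=> f; rewrite /r jE valK. Qed.

Let t_inj : injective t.
Proof.
move=> k l /(congr1 val) /= /(imset_inj x_inj) /setP /(_ k).
by rewrite !inE eqxx => /esym/negbFE/eqP.
Qed.

Let proj_t k : proj @: val (t k) = [set v].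
Proof.
have [l lk _] := third_index k k.
apply/eqP; rewrite eqEsubset sub1set; apply/andP; split.
  by apply/subsetP => y /imsetP[p /imsetP[m _ ->] ->]; rewrite inE proj_x.
by apply/imsetP; exists (x l); rewrite ?proj_x // mem_imset // !inE.
Qed.

Let rt k : r (t k) = s k.
Proof.
rewrite /r proj_t insubN.
  by case: pickP => [l /eqP/t_inj -> //|/(_ k)]; rewrite eqxx.
apply/edgesP => -[p [q [pq E]]].
have: p \in [set v] by rewrite E !inE eqxx.
have: q \in [set v] by rewrite E !inE eqxx orbT.
by rewrite !inE => /eqP qv /eqP pv; rewrite pv qv e_irr in pq.
Qed.

Let edgeP (u : edge e') :
  (exists k, u = t k) \/
  exists p q, [/\ e' p q, proj p != proj q, val u = [set p; q] & val (r u) = [set proj p; proj q]].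
Proof.
have /edgesP[p [q [pq uE]]] := valP u.
have [pqE|npq] := eqVneq (proj p) (proj q); [left|right].
  have pv : proj p = v.
    apply/eqP; apply: contraTT pq => pv.
    by rewrite (inj_proj pv) pqE -inj_proj ?e'_irr // -pqE.
  have [k pk] := x_proj pv; have [l ql] := x_proj (etrans (esym pqE) pv).
  have [m mk ml] := third_index k l; exists m; apply: val_inj; rewrite uE /=.
  have -> : [set~ m] = [set k; l].
    apply/eqP; rewrite eq_sym eqEcard cardsC1 card_ord cards2.
    by move: pq; rewrite pk ql e'_xx => ->; rewrite subUset !sub1set !inE ![_ == m]eq_sym mk ml.
  by rewrite imsetU1 imset_set1 pk ql.
exists p, q; split=> //; rewrite /r uE imsetU1 imset_set1.
have fP : [set proj p; proj q] \in edges e.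
  by apply/edgesP; exists (proj p), (proj q); rewrite e'_proj.
by rewrite (insubT (fun f => f \in edges e) fP).
Qed.

Let edge_inj (u u' : edge e') : ~ (exists k, u = t k) -> ~ (exists k, u' = t k) ->
  r u = r u' -> u = u'.
Proof.
case: (edgeP u) => // -[p [q [pq npq uE ruE]]] _.
case: (edgeP u') => // -[p1 [q1 [pq1 npq1 u1E ru1E]]] _ E; apply: val_inj.
rewrite uE u1E; move: (ruE); rewrite E ru1E => /setP H.
have := H (proj p); have := H (proj q); have := H (proj p1); rewrite !inE !eqxx ?orbT /=.
have [pp1|_] := eqVneq (proj p) (proj p1).
  rewrite -pp1 [proj q == proj p]eq_sym (negPf npq) /= => _ /eqP qE _.
  by have [-> ->] := lift_inj pq pq1 pp1 qE npq.
(* Here the ends of the two edges correspond crosswise. *)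
move=> /= /esym; rewrite eq_sym => p1q; rewrite -(eqP p1q) eqxx /= => _ /eqP pq1E.
rewrite e'_sym in pq1.
by have [-> ->] := lift_inj pq pq1 pq1E (eqP p1q) npq; rewrite setUC.
Qed.

Let j_nt f : ~ (exists k, j f = t k).
Proof.
case=> k E; have := jE f; rewrite E proj_t => H.
have /edgesP[y [z [yz fE]]] := valP f; move: H; rewrite fE => /setP H.
have := H y; have := H z; rewrite !inE !eqxx orbT => /eqP zv /eqP yv.
by rewrite yv zv e_irr in yz.
Qed.

Let edge'P u : u = j (r u) \/ exists k, u = t k.
Proof.
case: (edgeP u) => [|H]; [by right|left; apply: edge_inj (@j_nt _) _; last by rewrite jK].
case=> k uk; case: H => p [q [pq npq]]; rewrite uk => tE _.
have := proj_t k; rewrite tE imsetU1 imset_set1 => /setP H.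
by have := H (proj p); have := H (proj q); rewrite !inE !eqxx orbT /= => /esym/eqP qv /esym/eqP pv;
  rewrite pv qv eqxx in npq.
Qed.

Let s_adj k l : k != l -> adj_edges (s k) (s l).
Proof.
move=> kl; rewrite /adj_edges -val_eqE /=; apply/andP; split.
  apply: contraNneq kl => /setP/(_ (w k)); rewrite !inE eqxx orbT (negPf (w_neq k)) /=.
  by move/esym/eqP/w_inj ->.
by apply/set0Pn; exists v; rewrite !inE eqxx.
Qed.

Let mem_t k l : (x l \in val (t k)) = (l != k).
Proof. by rewrite /= mem_imset // !inE. Qed.

Let r_x (u : edge e') k : x k \in val u -> ~ (exists l, u = t l) -> r u = s k.
Proof.
case: (edgeP u) => // -[p [q [pq npq uE ruE]]] xu _; apply: val_inj; rewrite ruE /=.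
move: xu; rewrite uE !inE => /orP[] /eqP E; rewrite -E proj_x in npq *.
  rewrite eq_sym in npq; move: pq; rewrite -E (inj_proj npq) e'_xi //.
  by move/eqP => {1}->; rewrite injK.
move: pq; rewrite -E (inj_proj npq) e'_ix // => /eqP {1}->.
by rewrite injK setUC.
Qed.

(** If one of the edges lies in the triangle, the shared vertex is a corner and the images are two
    distinct edges at [v]. Otherwise the projection of the shared vertex is shared by the images. *)
Let r_adj u u' : adj_edges u u' -> adj_edges (r u) (r u').
Proof.
have Hs z z' k : z = t k -> adj_edges z z' -> adj_edges (r z) (r z').
  move=> -> /andP[nz /set0Pn[p]]; rewrite inE => /andP[/imsetP[l]].
  rewrite !inE => lk -> xl; rewrite rt; case: (edge'P z') => [E|[m E]].
    rewrite (r_x xl); first by rewrite s_adj // eq_sym.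
    by rewrite E; apply: j_nt.
  by rewrite E rt s_adj //; apply: contraNneq nz => km; rewrite E km.
case: (edge'P u) => [uE|[k]]; last exact: Hs.
case: (edge'P u') => [u'E|[k]]; last first.
  by move=> E uu'; rewrite adj_edges_sym; apply: Hs E _; rewrite adj_edges_sym.
case/andP=> nu /set0Pn[p]; rewrite inE => /andP[pu pu']; apply/andP; split.
  by apply: contraNneq nu => E; rewrite uE u'E E.
apply/set0Pn; exists (proj p); rewrite inE.
by rewrite -![val (r _)]jE -uE -u'E !imset_f.
Qed.

Let s_of (f : edge e) : v \in val f -> exists k, f = s k.
Proof.
have /edgesP[y [z [yz fE]]] := valP f; rewrite fE !inE => /orP[] /eqP vE.
  move: yz; rewrite -vE ev => /codomP[k zk]; exists k.
  by apply: val_inj; rewrite fE -vE zk.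
move: yz; rewrite -vE e_sym ev => /codomP[k zk]; exists k.
by apply: val_inj; rewrite fE -vE zk setUC.
Qed.

Let inj_j (f : edge e) y : y != v -> y \in val f -> inj y \in val (j f).
Proof.
move=> yv; rewrite -jE => /imsetP[p pj yE]; rewrite yE -inj_proj //.
by rewrite -yE.
Qed.

Let j_adj f g : adj_edges f g ->
  adj_edges (j f) (j g) \/ exists k l, f = s k /\ g = s l.
Proof.
case/andP=> nfg /set0Pn[y]; rewrite inE => /andP[yf yg].
have [yv|yv] := eqVneq y v; [right|left].
  rewrite yv in yf yg; have [k ->] := s_of yf; have [l ->] := s_of yg.
  by exists k, l.
rewrite /adj_edges (inj_eq (can_inj jK)) nfg /=; apply/set0Pn; exists (inj y).
by rewrite inE !inj_j.
Qed.

Let t_adj k l : k != l -> adj_edges (t k) (t l).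
Proof.
move=> kl; rewrite /adj_edges (inj_eq t_inj) kl /=.
have [m mk ml] := third_index k l; apply/set0Pn; exists (x m).
by rewrite in_setI !mem_t mk.
Qed.

Let st_adj k l : k != l -> adj_edges (j (s k)) (t l).
Proof.
move=> kl; apply/andP; split; first by apply/eqP => E; apply: (@j_nt (s k)); exists l.
apply/set0Pn; exists (x k); rewrite in_setI mem_t kl andbT.
have: v \in val (s k) by rewrite /= !inE eqxx.
(* The edge [j (s k)] passes through some corner [x m]; applying [r] gives [s m = s k], hence
   [m = k]. *)
rewrite -(jE (s k)) => /imsetP[p pj /esym/x_proj[m pE]].
have /(congr1 val)/setP/(_ (w m)) : s m = s k.
  by rewrite -(@r_x (j (s k)) m) -?pE ?jK //; apply: j_nt.
rewrite /= !inE eqxx orbT (negPf (w_neq m)) /= => /esym/eqP/w_inj mk.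
by rewrite -[X in x X]mk -pE.
Qed.

Lemma card_edges_triangle : #|edges e| + 3 <= #|edges e'|.
Proof.
rewrite -!card_edge -[3]card_ord -card_sum.
apply: (@leq_card _ _ (fun z => match z with inl f => j f | inr k => t k end)).
move=> [f|k] [g|l] //= E.
- by rewrite (can_inj jK E).
- by case: (@j_nt f); exists l.
- by case: (@j_nt g); exists k.
- by rewrite (t_inj E).
Qed.

Lemma separates_classes_triangle_graph (phi : coloring e -> bool) :
  separates_classes phi -> exists phi' : coloring e' -> bool, separates_classes phi'.
Proof. exact: (@separates_classes_triangle _ _ e e' j r s t
  jK rt edge'P r_adj j_adj t_adj st_adj phi). Qed.

(** * Rotation systems and faces under contraction *)

Section TriangleFaces.
Variable rho' : V' -> V' -> V'.
Hypothesis rho'P : rotation_system e' rho'.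

(** For [y] other than [v] and [z] adjacent to it, this is the unique neighbour of [inj y] over [z],
    a corner when [z] is [v]; the default is then not taken. *)
Let nb y z := odflt (inj z) [pick p | e' (inj y) p && (proj p == z)].

Let e'_proj_neq y p : y != v -> e' (inj y) p -> y != proj p.
Proof.
move=> yv; apply: contraTneq => E; have pv : proj p != v by rewrite -E.
by rewrite (inj_proj pv) -E e'_irr.
Qed.

Let nbP y z : y != v -> e y z -> e' (inj y) (nb y z) /\ proj (nb y z) = z.
Proof.
move=> yv /lift_adj[p [q [pq pE qE]]]; rewrite /nb; case: pickP => [q1 /andP[? /eqP]|] //.
by move/(_ q); rewrite qE eqxx -pE -inj_proj ?pq // pE.
Qed.

Let nbK y p : y != v -> e' (inj y) p -> nb y (proj p) = p.
Proof.
move=> yv yp; have npy := e'_proj_neq yv yp.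
have yz : e y (proj p) by rewrite -{1}(injK y) e'_proj // injK.
have [nb1 nb2] := nbP yv yz.
by have [] := lift_inj nb1 yp erefl nb2; rewrite ?nb2 ?injK.
Qed.

Let idx z := odflt ord0 [pick k | z == w k].

Let idxK k : idx (w k) = k.
Proof. by rewrite /idx; case: pickP => [l /eqP/w_inj|/(_ k)] //; rewrite eqxx. Qed.

(** Away from [v] the rotation is carried over by the bijection of neighbourhoods. The cyclic order
    at [v] stays a parameter, to be fixed by [triangle_link]. *)
Let rho o y z := if y == v then w (rot3 o (idx z)) else proj (rho' (inj y) (nb y z)).

Let rho_v o k : rho o v (w k) = w (rot3 o k).
Proof. by rewrite /rho eqxx idxK. Qed.

Let rho'_adj p q : e' p q -> e' p (rho' p q).
Proof. by move=> pq; have [cl _ _] := rho'P p; have := cl q; rewrite !inE => /(_ pq). Qed.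

Let rho_nv o y p : y != v -> e' (inj y) p -> rho o y (proj p) = proj (rho' (inj y) p).
Proof. by move=> yv yp; rewrite /rho (negPf yv) nbK. Qed.

Let rhoP o : rotation_system e (rho o).
Proof.
move=> y; have [->|yv] := eqVneq y v.
  split=> [z|z z1|z z1]; rewrite !inE !ev.
  - by case/codomP=> k ->; rewrite rho_v codom_f.
  - by case/codomP=> k -> /codomP[l ->]; rewrite !rho_v => /w_inj/rot3_inj ->.
  case/codomP=> k -> /codomP[l ->].
  have st h : fconnect (rho o v) (w h) (w (rot3 o h)) by rewrite -rho_v fconnect1.
  by case: (rot3_orbit o k l) => ->; [exact: connect0|exact: st|exact: connect_trans (st _) (st _)].
have [_ inj' conn] := rho'P (inj y).
split=> [z|z z1|z z1]; rewrite !inE.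
- case/(nbP yv) => ep pz; rewrite -pz rho_nv //.
  have ep1 := rho'_adj ep.
  by rewrite -{1}(injK y) e'_proj // injK e'_proj_neq.
- case/(nbP yv) => ep <- /(nbP yv)[ep1 <-]; rewrite !rho_nv // => E.
  have [] := lift_inj (rho'_adj ep) (rho'_adj ep1) erefl E.
    by rewrite injK e'_proj_neq // rho'_adj.
  by move=> _ /inj' ->; rewrite ?inE.
case/(nbP yv) => ep <- /(nbP yv)[ep1 <-].
have /iter_findex <- := conn _ _ (etrans (in_set _ _) ep) (etrans (in_set _ _) ep1).
elim: (findex _ _ _) => [|k IH] /=; first exact: connect0.
have itk : e' (inj y) (iter k (rho' (inj y)) (nb y z)) by elim: k {IH} => //= k /rho'_adj.
by apply: connect_trans IH _; rewrite -(rho_nv o) // fconnect1.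
Qed.

Let lift_dart (d : V * V) : V' * V' :=
  odflt (inj d.1, inj d.2)
    [pick d' | [&& e' d'.1 d'.2, proj d'.1 == d.1 & proj d'.2 == d.2]].

Let lift_dartE p q : e' p q -> proj p != proj q -> lift_dart (proj p, proj q) = (p, q).
Proof.
move=> pq npq; rewrite /lift_dart; case: pickP => [[p1 q1]|/(_ (p, q))] /=.
  by case/and3P=> pq1 /eqP pE /eqP qE; have [-> ->] := lift_inj pq pq1 (esym pE) (esym qE) npq.
by rewrite pq !eqxx.
Qed.

Let nbhd_x k o : nbhd e' (x k) = [set inj (w k); x (rot3 o k); x (rot3 (~~ o) k)].
Proof.
apply/setP => q; rewrite !inE; case: (V'P q) => [[qv qE]|[l ->]].
  by rewrite qE e'_xi // (inj_eq (can_inj injK)) ![inj _ == x _]eq_sym !x_neq_inj ?orbF.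
rewrite e'_xx x_neq_inj // !(inj_eq x_inj).
by case: (I3P k) => ->; case: (I3P l) => ->; case: o.
Qed.

(** Label each dart of [e] by the face of its lift, after merging the two faces [P] and [Q] given by
    [triangle_link]. The label is constant along the faces of the contracted rotation system, and at
    most [Q] is not a label. *)
Lemma card_faces_triangle : exists2 rho0 : V -> V -> V,
  rotation_system e rho0 & #|faces e' rho'| <= (#|faces e rho0|).+1.
Proof.
pose K := face_of e' rho'.
have Kstep p q : e' p q -> K (p, q) = K (q, rho' q p).
  move=> pq; symmetry; apply: (@face_of_step _ _ _ rho'P e'_sym (p, q)).
  by rewrite inE.
have wx k : e' (inj (w k)) (x k) by rewrite e'_ix.
have xw k : e' (x k) (inj (w k)) by rewrite e'_xi.
have [|o [P [Q link]]] := @triangle_link _ (fun k => K (inj (w k), x k))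
    (fun k => K (x k, inj (w k))) (fun k l => K (x k, x l)).
  move=> k; have u3 : uniq [:: inj (w k); x (rot3 true k); x (rot3 false k)].
    rewrite /= !inE ![inj _ == _]eq_sym !x_neq_inj // (inj_eq x_inj) /=.
    by case: (I3P k) => ->.
  have n3 o : rot3 o k != k by case: (I3P k) => ->; case: o.
  have [[E1 E2 E3]|[E1 E2 E3]] := rotation_three rho'P (nbhd_x k true) u3;
    [exists true|exists false]; split=> /=; by rewrite [LHS]Kstep ?e'_xx ?n3 // ?E1 ?E2 ?E3.
exists (rho o); first exact: rhoP.
pose m X := if X == Q then P else X.
have [|Ka Kb] := link _ m; first by rewrite /m eqxx; case: ifP.
have liftA k : lift_dart (w k, v) = (inj (w k), x k).
  by rewrite -{1}(injK (w k)) -(proj_x k) lift_dartE // proj_x injK.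
have liftB k : lift_dart (v, w k) = (x k, inj (w k)).
  by rewrite -{1}(injK (w k)) -(proj_x k) lift_dartE // proj_x injK eq_sym.
pose g d := m (K (lift_dart d)).
have gstep : {in darts e, forall d, g (face_step (rho o) d) = g d}.
  case=> z y; rewrite inE /= /face_step /= => zy; rewrite /g.
  have [yv|yv] := eqVneq y v.
    move: zy; rewrite yv e_sym ev => /codomP[k ->].
    by rewrite rho_v liftA liftB Ka.
  rewrite e_sym in zy; have [ep <-] := nbP yv zy; set p := nb y z in ep *.
  rewrite rho_nv //; have ep1 := rho'_adj ep.
  have -> : lift_dart (y, proj (rho' (inj y) p)) = (inj y, rho' (inj y) p).
    by have := lift_dartE ep1; rewrite injK => -> //; apply: e'_proj_neq.
  have -> : lift_dart (proj p, y) = (p, inj y).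
    have := @lift_dartE p (inj y); rewrite injK e'_sym eq_sym => -> //.
    exact: e'_proj_neq.
  by rewrite -Kstep // e'_sym.
suff sub : faces e' rho' :\ Q \subset g @: darts e.
  rewrite (cardsD1 Q) -addn1 addnC leq_add ?leq_b1 //.
  exact: leq_trans (subset_leq_card sub) (card_faces_ge (rhoP o) e_sym gstep).
apply/subsetP => X; rewrite in_setD1 => /andP[XQ /imsetP[[p q]]]; rewrite inE /= => pq XE.
have {XQ} -> : X = m (K (p, q)) by rewrite /K /face_of -XE /m (negPf XQ).
(* A dart outside the triangle is the lift of its projection. A dart inside shares its merged face
   with a dart entering the triangle, which is the lift of some [(w h, v)]. *)
have [pqE|npq] := eqVneq (proj p) (proj q); last first.
  by apply/imsetP; exists (proj p, proj q); rewrite ?inE ?e'_proj // /g lift_dartE.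
have pv : proj p = v.
  apply/eqP; apply: contraTT pq => pv.
  by rewrite (inj_proj pv) pqE -inj_proj ?e'_irr // -pqE.
have [k pk] := x_proj pv; have [l ql] := x_proj (etrans (esym pqE) pv).
rewrite pk ql e'_xx in pq *; have [h ->] := Kb k l pq.
by apply/imsetP; exists (w h, v); rewrite ?inE /= ?[e _ v]e_sym ?ev ?codom_f // /g liftA.
Qed.

End TriangleFaces.

End Triangle.

Lemma index3_unique (x y z z' : 'I_3) :
  x != y -> z != x -> z != y -> z' != x -> z' != y -> z = z'.
Proof.
by case: (I3P x) => ->; case: (I3P y) => -> //; case: (I3P z) => -> //;
   case: (I3P z') => ->.
Qed.

(** * The complete bipartite graph K_{3,3} *)

Section K33.

Let L (k : 'I_3) : 'I_6 := lshift 3 k.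
Let R (k : 'I_3) : 'I_6 := rshift 3 k.

Definition K33 : rel 'I_6 := [rel x y : 'I_6 | (x < 3) (+) (y < 3)].

Let LRP (y : 'I_6) : (exists k, y = L k) \/ (exists k, y = R k).
Proof.
rewrite -(@splitK 3 3 y); case: (split _) => k /=; [left|right]; by exists k.
Qed.

Let ltL k : (L k < 3) = true. Proof. exact: (ltn_ord k). Qed.
Let ltR k : (R k < 3) = false. Proof. by []. Qed.
Let L_inj : injective L. Proof. exact: (@lshift_inj 3 3). Qed.
Let R_inj : injective R. Proof. exact: (@rshift_inj 3 3). Qed.
Let LR k l : (L k == R l) = false.
Proof. by apply/eqP => E; have := ltL k; rewrite E ltR. Qed.

Lemma K33_sym : symmetric K33.
Proof. by move=> x y; rewrite /K33 /= addbC. Qed.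

Lemma K33_irr : irreflexive K33.
Proof. by move=> x; rewrite /K33 /= addbb. Qed.

Let KLR k l : K33 (L k) (R l). Proof. by rewrite /K33 /= ltL. Qed.

Let K33P x y : K33 x y ->
  exists k l, (x = L k /\ y = R l) \/ (x = R k /\ y = L l).
Proof.
case: (LRP x) => -[k ->]; case: (LRP y) => -[l ->]; rewrite /K33 /= ?ltL ?ltR // => _;
exists k, l; by [left|right].
Qed.

Let nbhdL k : nbhd K33 (L k) = R @: setT.
Proof.
apply/setP => y; rewrite inE; case: (LRP y) => -[l ->].
  rewrite /K33 /= !ltL; symmetry; apply/imsetP => -[h _ /eqP]; by rewrite LR.
by rewrite KLR imset_f.
Qed.

Let nbhdR k : nbhd K33 (R k) = L @: setT.
Proof.
apply/setP => y; rewrite inE; case: (LRP y) => -[l ->].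
  by rewrite K33_sym KLR imset_f.
rewrite /K33 /= !ltR; symmetry; apply/imsetP => -[h _ /eqP]; by rewrite eq_sym LR.
Qed.

Lemma K33_cubic : cubic K33.
Proof.
move=> y; case: (LRP y) => -[k ->]; rewrite ?nbhdL ?nbhdR card_imset // cardsT card_ord //.
Qed.

(** Two removals leave a vertex on each side, and every surviving vertex reaches this adjacent
    pair. *)
Lemma K33_three_connected : three_connected K33.
Proof.
split=> [|X X2]; first by rewrite card_ord.
have avoid (h : 'I_3 -> 'I_6) : injective h -> exists k, h k \notin X.
  move=> hinj; have /subsetPn[_ /imsetP[k _ ->] kX] : ~~ (h @: setT \subset X).
    by apply: contraL X2 => /subset_leq_card; rewrite card_imset // cardsT card_ord -ltnNge.
  by exists k.
have [k kX] := avoid _ L_inj; have [l lX] := avoid _ R_inj.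
pose E := connect [rel x y | [&& K33 x y, x \in ~: X & y \in ~: X]].
have E1 x y : K33 x y -> x \notin X -> y \notin X -> E x y.
  by move=> xy xX yX; apply: connect1; rewrite /= !inE xy xX yX.
have ER x : x \notin X -> E x (R l).
  case: (LRP x) => -[h ->] hX; first exact: E1.
  by apply: (@connect_trans _ _ (L k)); apply: E1; rewrite // K33_sym.
have EL x : x \notin X -> E (R l) x.
  case: (LRP x) => -[h ->] hX; first by apply: E1; rewrite // K33_sym.
  by apply: (@connect_trans _ _ (L k)); apply: E1; rewrite // K33_sym.
by move=> x y; rewrite !inE => /ER xR /EL; apply: connect_trans.
Qed.

Let EP k l : [set L k; R l] \in edges K33.
Proof. by apply/edgesP; exists (L k), (R l). Qed.

Let E k l : edge K33 := exist (fun X => X \in edges K33) _ (EP k l).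

Let edgeE f : exists k l, f = E k l.
Proof.
have /edgesP[x [y [xy fE]]] := valP f.
have [k [l [[xE yE]|[xE yE]]]] := K33P xy; [exists k, l|exists l, k];
by apply: val_inj; rewrite fE xE yE //= setUC.
Qed.

Let memL h k l : (L h \in val (E k l)) = (h == k).
Proof. by rewrite !inE LR orbF (inj_eq L_inj). Qed.

Let memR h k l : (R h \in val (E k l)) = (h == l).
Proof. by rewrite !inE eq_sym LR (inj_eq R_inj). Qed.

Let E_eq k l k' l' : (E k l == E k' l') = (k == k') && (l == l').
Proof.
apply/eqP/andP => [H|[/eqP -> /eqP -> //]]; split.
  by rewrite -(memL k k' l') -H memL.
by rewrite -(memR l k' l') -H memR.
Qed.

(** Edges are the cells of a 3 by 3 array; distinct cells are adjacent when they share a row or a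
    column, which is the Latin square condition. *)
Let adjE k l k' l' : adj_edges (E k l) (E k' l') = (k == k') (+) (l == l').
Proof.
rewrite /adj_edges E_eq.
have -> : (val (E k l) :&: val (E k' l') != set0) = (k == k') || (l == l').
  apply/set0Pn/orP => [[x]|[] /eqP ->].
  - by rewrite inE; case: (LRP x) => -[h ->]; rewrite ?memL ?memR => /andP[/eqP -> ->]; auto.
  - by exists (L k'); rewrite inE !memL eqxx.
  - by exists (R l'); rewrite inE !memR eqxx.
by case: (k == k'); case: (l == l').
Qed.

Lemma K33_card_edges : 9 <= #|edges K33|.
Proof.
have <- : #|{: 'I_3 * 'I_3}| = 9 by rewrite card_prod card_ord.
rewrite -card_edge; apply: (@leq_card _ _ (fun p => E p.1 p.2)).
by case=> k l [k' l'] /= /eqP; rewrite E_eq => /andP[/eqP -> /eqP ->].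
Qed.

(* Consecutive darts of a face start on alternating sides, and a face does not
   turn back, so its first four darts are distinct. *)
Lemma K33_card_faces rho : rotation_system K33 rho -> #|faces K33 rho| <= 4.
Proof.
move=> rhoP; have D18 : #|darts K33| <= 18.
  pose h (p : bool * ('I_3 * 'I_3)) :=
    if p.1 then (L p.2.1, R p.2.2) else (R p.2.1, L p.2.2).
  have <- : #|[set: bool * ('I_3 * 'I_3)]| = 18.
    by rewrite cardsT !card_prod card_bool card_ord.
  apply: leq_trans (leq_imset_card h _); apply/subset_leq_card/subsetP => -[x y].
  rewrite inE /= => /K33P[k [l [[-> ->]|[-> ->]]]]; apply/imsetP.
    by exists (true, (k, l)); rewrite ?inE.
  by exists (false, (k, l)); rewrite ?inE.
suff F4 : 4 * #|faces K33 rho| <= #|darts K33|.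
  (* Four times the number of faces is at most 18, hence below 20. *)
  by rewrite -ltnS -(@ltn_pmul2l 4) //; apply: leq_ltn_trans F4 (leq_ltn_trans D18 _).
rewrite -[X in _ <= X]sum1_card facesE (partition_big_imset (face_of K33 rho)) /=.
rewrite mulnC -sum_nat_const; apply: leq_sum => _ /imsetP[d dD ->].
rewrite sum1_card; pose f := face_step rho.
have fD y : y \in darts K33 -> f y \in darts K33 by apply: face_step_dart rhoP K33_sym _.
have fface y : y \in darts K33 -> face_of K33 rho (f y) = face_of K33 rho y.
  by apply: face_of_step rhoP K33_sym _.
have [d1 d2] := (fD _ dD, fD _ (fD _ dD)); have d3 := fD _ d2.
have alt y : y \in darts K33 -> ((f y).1 < 3) = ~~ (y.1 < 3).
  by case: y => p q; rewrite inE /K33 /=; case: (p < 3); case: (q < 3).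
have ff y : y \in darts K33 -> (f (f y)).1 != y.1.
  case: y => p q; rewrite inE /= => pq.
  have [q1 qq1 npq] : exists2 q1, K33 q q1 & p != q1.
    have: 0 < #|nbhd K33 q :\ p|.
      have := K33_cubic q; rewrite (cardsD1 p) inE K33_sym pq.
      by case: #|_| => //.
    case/card_gt0P=> q1; rewrite !inE => /andP[n qq1]; exists q1 => //.
    by rewrite eq_sym.
  by apply: (rotation_fixfree rhoP _ qq1 npq); rewrite K33_sym.
have ne (y z : 'I_6 * 'I_6) : (y.1 < 3) != (z.1 < 3) -> y != z by apply: contraNneq => ->.
have ne1 (y z : 'I_6 * 'I_6) : y.1 != z.1 -> y != z by apply: contraNneq => ->.
have u4 : uniq [:: d; f d; f (f d); f (f (f d))].
  rewrite /= !inE !negb_or !andbT -!andbA; apply/and5P; split; last (apply/andP; split).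
  - by apply: ne; rewrite alt //; case: (_ < _).
  - by rewrite eq_sym ne1 // ff.
  - by apply: ne; rewrite !alt //; case: (_ < _).
  - by apply: ne; rewrite !alt //; case: (_ < _).
  - by rewrite eq_sym ne1 // ff.
  - by apply: ne; rewrite !alt //; case: (_ < _).
apply: (@leq_trans #|[:: d; f d; f (f d); f (f (f d))]|).
  by rewrite (card_uniqP u4).
apply/subset_leq_card/subsetP => y; rewrite !inE.
by case/or4P=> /eqP ->; apply/andP; split; rewrite ?fface // -[K33 _ _](inE).
Qed.

Let c_row (c : coloring K33) k l l' : proper c -> l != l' -> c (E k l) != c (E k l').
Proof. by move=> /proper_coloringP pc ll; apply: pc; rewrite adjE eqxx (negPf ll). Qed.

Let c_col (c : coloring K33) k k' l : proper c -> k != k' -> c (E k l) != c (E k' l).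
Proof. by move=> /proper_coloringP pc kk; apply: pc; rewrite adjE eqxx (negPf kk). Qed.

(** Row 1 is a cyclic shift of row 0 in one of two directions. The diagonal entries agree exactly
    for the circulant squares. *)
Let phi (c : coloring K33) : bool := c (E i1 i1) == c (E i0 i0).

Let phiP c : proper c ->
  [/\ c (E i1 i0) = c (E i0 (if phi c then i2 else i1)),
      c (E i1 i1) = c (E i0 (if phi c then i0 else i2)) &
      c (E i1 i2) = c (E i0 (if phi c then i1 else i0))].
Proof.
move=> pc; rewrite /phi.
have r k l l' : l != l' -> c (E k l) != c (E k l') by apply: c_row.
have q k k' l : k != k' -> c (E k l) != c (E k' l) by apply: c_col.
have u := @index3_unique.
case: eqP => [E11|/eqP N11].
  have E12 : c (E i1 i2) = c (E i0 i1).
    by apply: (u (c (E i0 i0)) (c (E i0 i2))); rewrite ?r ?q // -E11 r.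
  by split=> //; apply: (u (c (E i0 i0)) (c (E i0 i1))); rewrite ?r ?q // -E12 r.
have E11 : c (E i1 i1) = c (E i0 i2).
  by apply: (u (c (E i0 i0)) (c (E i0 i1))); rewrite ?r ?q.
have E10 : c (E i1 i0) = c (E i0 i1).
  by apply: (u (c (E i0 i0)) (c (E i0 i2))); rewrite ?r ?q // -E11 r.
by split=> //; apply: (u (c (E i0 i1)) (c (E i0 i2))); rewrite ?r ?q // -E10 r.
Qed.

(** Two entries fix row 0, the value of [phi] then fixes row 1, and row 2 follows by exclusion in
    each column. *)
Let coloring_det c d : proper c -> proper d -> phi c = phi d ->
  c (E i0 i0) = d (E i0 i0) -> c (E i0 i1) = d (E i0 i1) -> c = d.
Proof.
move=> pc pd pcd E00 E01.
have E0 l : c (E i0 l) = d (E i0 l).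
  case: (I3P l) => -> //.
  by apply: (@index3_unique (c (E i0 i0)) (c (E i0 i1))); rewrite ?c_row // ?E00 ?E01 c_row.
have E1 l : c (E i1 l) = d (E i1 l).
  have [c0 c1 c2] := phiP pc; have [d0 d1 d2] := phiP pd.
  by case: (I3P l) => ->; rewrite ?c0 ?c1 ?c2 ?d0 ?d1 ?d2 pcd E0.
apply/ffunP => f; have [k [l ->]] := edgeE f; case: (I3P k) => -> //.
by apply: (@index3_unique (c (E i0 l)) (c (E i1 l))); rewrite ?c_col // ?E0 ?E1 c_col.
Qed.

(* Each colour class on its own already determines [phi]; a switch on the
   colours [a] and [b] leaves the third colour class unchanged. *)
Let phi_switch c a b f : proper c -> a != b -> ab_col c a b f ->
  phi (kempe_switch c a b f) = phi c.
Proof.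
move=> pc ab fab; set d := kempe_switch c a b f.
have pd : proper d by apply: kempe_switch_proper.
have [z za zb] := third_index a b.
have same g : (d g == z) = (c g == z).
  rewrite /d ffunE; case: ifP => // /(ab_col_chain fab) gab.
  have := swap_col_ab gab; rewrite /ab_col in gab *.
  by case/orP: gab => /eqP -> /orP[] /eqP ->; rewrite ![_ == z]eq_sym ?(negPf za) ?(negPf zb).
(* From row 0 to row 1 the colour [z] moves one place cyclically, forward exactly when [phi]
   holds. *)
have cls c1 l : proper c1 -> c1 (E i0 l) = z -> phi c1 = (c1 (E i1 (rot3 true l)) == z).
  move=> pc1 <-; have [c0 c1' c2] := phiP pc1.
  have ne h h' : h != h' -> (c1 (E i0 h) == c1 (E i0 h')) = false.
    by move=> hh; apply/negbTE/c_row.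
  case: (I3P l) => -> /=; rewrite /rot3 /= ?c0 ?c1' ?c2;
  by case: (phi c1); rewrite ?eqxx // ne.
have [l lz] : exists l, c (E i0 l) = z.
  have rinj : injective (fun l => c (E i0 l)).
    by move=> h h' hh; apply/eqP; apply: contraT => /(c_row i0 pc); rewrite hh eqxx.
  by have /codomP[l ->] := injF_onto rinj z; exists l.
have dz : d (E i0 l) = z by apply/eqP; rewrite same lz.
by rewrite (cls d l) // (cls c l) // same.
Qed.

Let phi_equiv c d : kempe_equiv c d -> phi c = phi d.
Proof.
have step c1 c2 : kempe_step c1 c2 -> phi c1 = phi c2.
  by case/kempe_stepP=> pc _ [a [b [f [ab fab ->]]]]; rewrite phi_switch.
move/connectP=> [p]; elim: p c => [|c1 p IH] c /=; first by move=> _ ->.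
by case/andP=> /orP[/step ->|/step <-]; apply: IH.
Qed.

Let recolor00 c a : proper c -> exists2 c1, proper c1 & kempe_equiv c c1 /\ c1 (E i0 i0) = a.
Proof.
move=> pc; have [<-|na] := eqVneq (c (E i0 i0)) a;
  first by exists c => //; split=> //; apply: connect0.
have col : ab_col c (c (E i0 i0)) a (E i0 i0) by rewrite /ab_col eqxx.
exists (kempe_switch c (c (E i0 i0)) a (E i0 i0)); first exact: kempe_switch_proper.
split; first exact: kempe_equiv_step.
by rewrite ffunE inE connect0 /swap_col eqxx.
Qed.

(** Both switched colours differ from that of [E i0 i0], so this entry is kept. *)
Let recolor01 c a : proper c -> a != c (E i0 i0) -> exists2 c1, proper c1 &
  [/\ kempe_equiv c c1, c1 (E i0 i0) = c (E i0 i0) & c1 (E i0 i1) = a].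
Proof.
move=> pc a0; have [<-|na] := eqVneq (c (E i0 i1)) a;
  first by exists c => //; split=> //; apply: connect0.
have col : ab_col c (c (E i0 i1)) a (E i0 i1) by rewrite /ab_col eqxx.
exists (kempe_switch c (c (E i0 i1)) a (E i0 i1)); first exact: kempe_switch_proper.
split; first exact: kempe_equiv_step.
  rewrite ffunE /swap_col (negPf (c_row i0 pc _)) // eq_sym (negPf a0).
  by case: ifP.
by rewrite ffunE inE connect0 /swap_col eqxx.
Qed.

Lemma K33_separates : exists phi : coloring K33 -> bool, separates_classes phi.
Proof.
exists phi; split=> [c d pc pd|t].
  apply/idP/eqP => [|pcd]; first exact: phi_equiv.
  (* At most two switches bring the first two entries of row 0 to those of [d]; invariance of [phi]
     and [coloring_det] do the rest. *)
  have [c1 pc1 [cc1 E00]] := recolor00 (d (E i0 i0)) pc.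
  have [|c2 pc2 [c12 E00' E01]] := @recolor01 c1 (d (E i0 i1)) pc1.
    by rewrite E00 c_row.
  have cc2 := connect_trans cc1 c12; suff <- : c2 = d by [].
  by apply: coloring_det; rewrite // -?(phi_equiv cc2) // E00'.
pose un f := odflt (i0, i0) [pick p | f == E p.1 p.2].
have unK k l : un (E k l) = (k, l).
  rewrite /un; case: pickP => [[k' l']|/(_ (k, l))]; last by rewrite eqxx.
  by rewrite /= E_eq => /andP[/eqP -> /eqP ->].
(* Each row shifts the previous one cyclically. Stepping backwards when [t] holds makes the entry at
   (1,1) equal to the one at (0,0). *)
pose c : coloring K33 := [ffun f => let p := un f in iter p.1 (rot3 (~~ t)) p.2].
exists c; last by rewrite /phi /c !ffunE !unK /=; case: t {c}.
apply/proper_coloringP => f g; have [k [l ->]] := edgeE f; have [k' [l' ->]] := edgeE g.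
rewrite adjE /c !ffunE !unK /=.
by case: (I3P k) => ->; case: (I3P l) => ->; case: (I3P k') => ->;
   case: (I3P l') => -> //; case: t {c}.
Qed.

End K33.

(** * The family of graphs *)

(** The induction invariant: nonplanarity and the class count appear in the stronger or more
    explicit forms that survive triangle replacement. *)
Definition nonplanar_two_class (n : nat) (e : rel 'I_n) : Prop :=
  [/\ [/\ symmetric e, irreflexive e, cubic e & three_connected e],
      forall rho, rotation_system e rho -> n + #|faces e rho| < #|edges e| + 2 &
      exists phi : coloring e -> bool, separates_classes phi].

Lemma nonplanar_two_class_K33 : nonplanar_two_class K33.
Proof.
split; last exact: K33_separates.
  split; [exact: K33_sym|exact: K33_irr|exact: K33_cubic|exact: K33_three_connected].
(* Here V + F is at most 6 + 4, while E + 2 is at least 9 + 2. *)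
move=> rho /K33_card_faces F4; apply: (@leq_trans (9 + 2)).
  by rewrite ltnS (leq_add2l 6 _ 4).
by rewrite leq_add2r K33_card_edges.
Qed.

Lemma card3_index (T : finType) (A : {set T}) : #|A| = 3 ->
  exists2 w : 'I_3 -> T, injective w & forall y, (y \in A) = (y \in codom w).
Proof.
move=> A3; exists (fun k => enum_val (cast_ord (esym A3) k)).
  by move=> k l /enum_val_inj/cast_ord_inj.
move=> y; apply/idP/codomP => [yA|[k ->]]; last exact: enum_valP.
by exists (cast_ord A3 (enum_rank_in yA y)); rewrite cast_ordK enum_rankK_in.
Qed.

Lemma nonplanar_two_class_triangle m (e : rel 'I_(m + 1)) :
  nonplanar_two_class e -> exists e' : rel 'I_(m + 3), nonplanar_two_class e'.
Proof.
case=> -[e_sym e_irr e3 e_conn] e_faces [phi phiP].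
(* The last vertex is expanded: the first [m] keep their indices and the corners take the three new
   last ones. *)
pose v : 'I_(m + 1) := rshift m ord0.
have [w w_inj ev] := card3_index (e3 v).
pose I (a : 'I_m) : 'I_(m + 1) := lshift 1 a.
pose J (a : 'I_m) : 'I_(m + 3) := lshift 3 a.
pose x (k : 'I_3) : 'I_(m + 3) := rshift m k.
pose e' : rel 'I_(m + 3) := fun p q =>
  match split p, split q with
  | inl a, inl b => e (I a) (I b)
  | inl a, inr k => I a == w k
  | inr k, inl a => I a == w k
  | inr k, inr l => k != l
  end.
pose inj (y : 'I_(m + 1)) := if split y is inl a then J a else x i0.
pose proj (p : 'I_(m + 3)) := if split p is inl a then I a else v.
have sI a : split (I a) = inl a by exact: (unsplitK (inl a)).
have sJ a : split (J a) = inl a by exact: (unsplitK (inl a)).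
have sx k : split (x k) = inr k by exact: (unsplitK (inr k)).
have sv : split v = inr ord0 by exact: (unsplitK (inr ord0)).
have VP y : y = v \/ exists a, y = I a.
  rewrite -(splitK y); case: (split y) => a /=; [by right; exists a|left].
  by rewrite [a]ord1.
have V'P' p : (exists a, p = J a) \/ exists k, p = x k.
  by rewrite -(splitK p); case: (split p) => a; [left|right]; exists a.
have Iv a : I a != v by apply/eqP => /(congr1 (@split _ _)); rewrite sI sv.
have NV y : y != v -> exists a, y = I a by case: (VP y) => [->|//]; rewrite eqxx.
have x_inj : injective x by apply: rshift_inj.
have injK : cancel inj proj.
  by move=> y; case: (VP y) => [->|[a ->]]; rewrite /inj ?sv ?sI /proj ?sx ?sJ.
have proj_x k : proj (x k) = v by rewrite /proj sx.
have V'P p : (proj p != v /\ p = inj (proj p)) \/ exists k, p = x k.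
  case: (V'P' p) => [[a ->]|]; [left|by right].
  by rewrite /proj sJ /inj sI.
have ev' y : e v y = (y \in codom w) by rewrite -ev inE.
have e'_ii y z : y != v -> z != v -> e' (inj y) (inj z) = e y z.
  by move=> /NV[a ->] /NV[b ->]; rewrite /inj !sI /e' !sJ.
have e'_ix y k : y != v -> e' (inj y) (x k) = (y == w k).
  by move=> /NV[a ->]; rewrite /inj sI /e' sJ sx.
have e'_xx k l : e' (x k) (x l) = (k != l) by rewrite /e' !sx.
have e'_sym : symmetric e'.
  move=> p q; rewrite /e'; case: (split p) => a; case: (split q) => b //.
  by rewrite eq_sym.
exists e'; split.
- split=> //.
  + move=> p; case: (V'P' p) => [[a ->]|[k ->]]; last by rewrite e'_xx eqxx.
    by rewrite /e' sJ.
  + exact: (cubic_triangle e_sym e_irr w_inj x_inj injK proj_x V'P ev' e'_ii e'_ix e'_xx e'_sym).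
  + exact: (three_connected_triangle e_sym e_irr w_inj x_inj injK proj_x
      V'P ev' e'_ii e'_ix e'_xx e'_sym).
- move=> rho' rho'P.
  have [rho0 /e_faces H0 H1] :=
    card_faces_triangle e_sym e_irr w_inj x_inj injK proj_x V'P ev' e'_ii e'_ix e'_xx e'_sym rho'P.
  have Ed := card_edges_triangle e_sym e_irr x_inj injK proj_x ev' e'_ii e'_ix e'_xx e'_sym.
  (* V grows by 2, F by at most 1 and E by at least 3, so the strict inequality persists. *)
  by move: H0 H1 Ed; lia.
exact: (separates_classes_triangle_graph e_sym e_irr w_inj x_inj injK proj_x
  V'P ev' e'_ii e'_ix e'_xx e'_sym phiP).
Qed.

Lemma nonplanar_two_class_even k : exists e : rel 'I_(6 + k.*2), nonplanar_two_class e.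
Proof.
elim: k => [|k [e eG]]; first by exists K33; exact: nonplanar_two_class_K33.
have E1 : 6 + k.*2 = 5 + k.*2 + 1 by rewrite addn1.
have -> : 6 + k.+1.*2 = 5 + k.*2 + 3 by rewrite doubleS !addnS addn0.
rewrite E1 in e eG; exact: nonplanar_two_class_triangle eG.
Qed.

Unset Implicit Arguments.

Theorem theorem19 (n : nat) :
  8 <= n -> ~~ odd n ->
  exists e : rel 'I_n,
    [/\ symmetric e, irreflexive e, cubic e & three_connected e] /\
        ~ planar e /\ Kprime3 e = 2.
Proof.
move=> n8 n_even; have -> : n = 6 + (n - 6)./2.*2.
  by rewrite even_halfK ?subnKC ?oddB ?(negPf n_even) //; apply: leq_trans n8.
have [e [eG eF [phi phiP]]] := nonplanar_two_class_even (n - 6)./2; exists e; split=> //.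
split; last exact: Kprime3_eq2 phiP.
by case=> rho [/eF]; rewrite card_ord => H E; rewrite E ltnn in H.
Qed.
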